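(* Let $k$ be a field of characteristic $0$, let $\mathcal F=k\langle \mathbf c,\mathbf d\rangle$ be the free associative algebra (concatenation product, unit $1$) in non-commuting variables $\mathbf c,\mathbf d$, and let $\hat{\mathcal F}=k\,e\oplus\mathcal F$, where $e$ is a formal symbol. Let $\Delta:\mathcal F\to\mathcal F\otimes\mathcal F$ be the linear map determined by $\Delta(1)=0$, $\Delta(\mathbf c)=2(1\otimes 1)$, $\Delta(\mathbf d)=1\otimes\mathbf c+\mathbf c\otimes 1$ and $\Delta(uv)=\Delta(u)v+u\Delta(v)$ for $u,v\in\mathcal F$, where $(x\otimes y)v=x\otimes yv$ and $u(x\otimes y)=ux\otimes y$. Define $\hat\Delta:\hat{\mathcal F}\to\hat{\mathcal F}\otimes\hat{\mathcal F}$ by $\hat\Delta(e)=e\otimes e$ and $\hat\Delta(u)=\Delta(u)+e\otimes u+u\otimes e$ for $u\in\mathcal F$. Let $G:\mathcal F\to\mathcal F$ be the linear map determined by $G(1)=0$, $G(\mathbf c)=\mathbf d$, $G(\mathbf d)=\mathbf c\mathbf d$ and $G(uv)=G(u)v+uG(v)$, and define $\hat G:\hat{\mathcal F}\to\hat{\mathcal F}$ linearly by $\hat G(e)=1$ and $\hat G(u)=G(u)+u\mathbf c$ for $u\in\mathcal F$. Then $$\hat\Delta\circ\hat G=(\mathrm{id}\otimes\hat G+\hat G\otimes\mathrm{id})\circ\hat\Delta$$ as maps $\hat{\mathcal F}\to\hat{\mathcal F}\otimes\hat{\mathcal F}$; that is, $\hat G$ is a coderivation with respect to $\hat\Delta$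.
   Context: Degrees: $\deg\mathbf c=1$, $\deg\mathbf d=2$, $\deg e=-1$. The maps $\Delta$ and $G$ are well defined by the stated rules. *)

(* Defs.v *)
From HB Require Import structures.
From mathcomp Require Import all_boot all_algebra.
From mathcomp Require Import finmap.
From mathcomp.multinomials Require Import monalg.
Set Implicit Arguments.
Unset Strict Implicit.
Unset Printing Implicit Defensive.
Import GRing.Theory.
Local Open Scope ring_scope.

Section LinearCombinations.
Variables (k : fieldType) (V : lmodType k) (a p q : k).
Implicit Types e t r s : V.

Lemma lin1 t1 t2 r1 r2 :
  a *: t1 + t2 + (a *: r1 + r2) = a *: (t1 + r1) + (t2 + r2).
Proof. by rewrite scalerDr addrACA. Qed.

Lemma lin2 e t1 t2 : (a * p + q) *: e + (a *: t1 + t2) =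
  a *: (p *: e + t1) + (q *: e + t2).
Proof. by rewrite scalerDl -scalerA lin1. Qed.

Lemma lin4 e t1 t2 r1 r2 s1 s2 :
  (a * p + q) *: e + (a *: t1 + t2 + (a *: r1 + r2) + (a *: s1 + s2)) =
  a *: (p *: e + (t1 + r1 + s1)) + (q *: e + (t2 + r2 + s2)).
Proof. by rewrite !lin1 lin2. Qed.

End LinearCombinations.

Section LinearPredicates.
Variable k : fieldType.

Lemma add_of_linear (V W : lmodType k) (f : V -> W) : linear f ->
  {morph f : x y / x + y}.
Proof. by move=> lf x y; rewrite -[x in LHS]scale1r lf scale1r. Qed.

Lemma zero_of_linear (U W : lmodType k) (f : U -> W) : linear f -> f 0 = 0.
Proof.
move=> lf; have := lf (-1) 0 0.
by rewrite scaleN1r oppr0 addr0 scaleN1r addNr.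
Qed.

Lemma linear_comp (U V W : lmodType k) (f : V -> W) (g : U -> V) :
  linear f -> linear g -> linear (fun x => f (g x)).
Proof. by move=> lf lg a x y; rewrite lg lf. Qed.

Lemma linear_comb (U V : lmodType k) (a : k) (f g : U -> V) :
  linear f -> linear g -> linear (fun x => a *: f x + g x).
Proof.
move=> lf lg b x y; rewrite lf lg scalerDr scalerA mulrC -scalerA.
exact: lin1.
Qed.

End LinearPredicates.

Section LinearExtension.
Variables (k : fieldType) (I : choiceType) (V : lmodType k).

Definition mlin (h : I -> V) (x : {malg k[I]}) : V :=
  \sum_(i <- msupp x) x@_i *: h i.

Lemma mlinEw (h : I -> V) (x : {malg k[I]}) (s : seq I) :
  uniq s -> {subset msupp x <= s} -> mlin h x = \sum_(i <- s) x@_i *: h i.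
Proof.
move=> us sub; rewrite [RHS](bigID (fun i => i \in msupp x)) /=.
rewrite [X in _ + X]big1 ?addr0; last first.
  by move=> i /mcoeff_outdom ->; rewrite scale0r.
rewrite -[RHS]big_filter; apply/perm_big/uniq_perm => //.
- exact: filter_uniq.
- move=> i; rewrite mem_filter; case: (boolP (i \in msupp x)) => //= ix.
  by rewrite (sub _ ix).
Qed.

Lemma mlin_is_linear (h : I -> V) : linear (mlin h).
Proof.
move=> a x y; pose s := undup (msupp x ++ msupp y ++ msupp (a *: x + y)).
have us : uniq s by exact: undup_uniq.
have sx : {subset msupp x <= s}.
  by move=> i ix; rewrite mem_undup !mem_cat ix.
have sy : {subset msupp y <= s}.
  by move=> i iy; rewrite mem_undup !mem_cat iy orbT.
have sxy : {subset msupp (a *: x + y) <= s}.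
  by move=> i ixy; rewrite mem_undup !mem_cat ixy !orbT.
rewrite (mlinEw h us sx) (mlinEw h us sy) (mlinEw h us sxy).
rewrite scaler_sumr -big_split /=.
by apply: eq_bigr => i _; rewrite mcoeffD mcoeffZ scalerDl scalerA.
Qed.

HB.instance Definition _ (h : I -> V) :=
  GRing.isLinear.Build k {malg k[I]} V _ (mlin h) (mlin_is_linear h).

Lemma mlinU (h : I -> V) (i : I) : mlin h << i >> = h i.
Proof.
rewrite (@mlinEw h _ [:: i]) ?big_seq1 ?mcoeffUU ?scale1r // => j.
by rewrite msuppU oner_eq0 in_fset1 inE.
Qed.

Lemma eq_on_basis (f g : {malg k[I]} -> V) :
  linear f -> linear g -> (forall i, f << i >> = g << i >>) -> f =1 g.
Proof.
move=> lf lg efg x; rewrite [x]monalgE.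
have fZ (h : {malg k[I]} -> V) : linear h -> forall s : seq I,
    h (\sum_(i <- s) << x@_i *g i >>) = \sum_(i <- s) x@_i *: h << i >>.
  move=> lh s.
  elim: s => [|i s IHs]; first by rewrite !big_nil (zero_of_linear lh).
  rewrite !big_cons -IHs -lh; congr (h (_ + _)); apply/malgP => j.
  by rewrite mcoeffZ !mcoeffU mulr_natr.
by rewrite !fZ //; apply: eq_bigr => i _; rewrite efg.
Qed.

End LinearExtension.

(* The tensor product of the k-modules with bases I and J, modelled as the
   k-module with basis I * J; see tens_universal. *)
Notation "{ 'tens' k [ I , J ] }" := {malg k[(I * J)%type]}
  (at level 0, k, I, J at level 2) : type_scope.

Section Tensor.
Variable k : fieldType.

Definition tens (I J : choiceType) (x : {malg k[I]}) (y : {malg k[J]}) :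
    {tens k[I, J]} :=
  mlin (fun i => mlin (fun j => << (i, j) >>) y) x.

Local Notation "x \ox y" := (tens x y) (at level 35).

Lemma tensUU (I J : choiceType) (i : I) (j : J) :
  << i >> \ox << j >> = << (i, j) >>.
Proof. by rewrite /tens !mlinU. Qed.

Lemma tens_linearl (I J : choiceType) (y : {malg k[J]}) :
  linear (fun x : {malg k[I]} => x \ox y).
Proof. by move=> a x x'; rewrite /tens linearP. Qed.

Lemma tens_linearr (I J : choiceType) (x : {malg k[I]}) :
  linear (fun y : {malg k[J]} => x \ox y).
Proof.
move=> a y y'; rewrite /tens /mlin scaler_sumr -big_split /=.
apply: eq_bigr => i _; rewrite -!/(mlin _ _) linearP scalerDr.
by rewrite !scalerA mulrC.
Qed.

Theorem tens_universal (I J : choiceType) (V : lmodType k)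
    (f : {malg k[I]} -> {malg k[J]} -> V) :
  (forall y, linear (f^~ y)) -> (forall x, linear (f x)) ->
  exists h : {linear {tens k[I, J]} -> V},
    (forall x y, h (x \ox y) = f x y) /\
    (forall h' : {linear {tens k[I, J]} -> V},
       (forall x y, h' (x \ox y) = f x y) -> h' =1 h).
Proof.
move=> fl fr; exists (mlin (fun p : I * J => f << p.1 >> << p.2 >>)); split.
- move=> x y; move: x; apply: eq_on_basis => [a x x'||i]; [|exact: fl|].
    by rewrite tens_linearl linearP.
  move: y; apply: eq_on_basis => [a y y'||j]; [|exact: fr|].
    by rewrite tens_linearr linearP.
  by rewrite tensUU /= mlinU.
- move=> h' h'E; apply: eq_on_basis => [||[i j]]; try exact: linearP.
  by rewrite -tensUU h'E tensUU /= mlinU.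
Qed.

Lemma eq_on_tens (I J : choiceType) (V : lmodType k) (f g : {tens k[I, J]} -> V) :
  linear f -> linear g -> (forall x y, f (x \ox y) = g (x \ox y)) -> f =1 g.
Proof.
by move=> lf lg fg; apply: eq_on_basis => // -[i j]; rewrite -tensUU.
Qed.

Section TensorMap.
Variables (I J I' J' : choiceType).
Variables (f : {linear {malg k[I]} -> {malg k[I']}}).
Variables (g : {linear {malg k[J]} -> {malg k[J']}}).

Definition tmap : {tens k[I, J]} -> {tens k[I', J']} :=
  mlin (fun p => f << p.1 >> \ox g << p.2 >>).

Lemma tmap_is_linear : linear tmap.
Proof. exact: mlin_is_linear. Qed.

HB.instance Definition _ :=
  GRing.isLinear.Build k {tens k[I, J]} {tens k[I', J']} _ tmap tmap_is_linear.

Lemma tmapE (x : {malg k[I]}) (y : {malg k[J]}) :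
  tmap (x \ox y) = f x \ox g y.
Proof.
move: x; apply: eq_on_basis => [a x x'|a x x'|i].
- by rewrite tens_linearl linearP.
- by rewrite linearP tens_linearl.
move: y; apply: eq_on_basis => [a y y'|a y y'|j].
- by rewrite tens_linearr linearP.
- by rewrite linearP tens_linearr.
by rewrite tensUU /tmap mlinU.
Qed.

End TensorMap.
End Tensor.

Notation "x \ox y" := (tens x y) (at level 35) : ring_scope.

(* Letters are booleans: false stands for c and true for d. *)
Notation cdword := {fmonom bool}.
Notation cdalg k := {malg k[cdword]}.

(* k e (+) F, with basis the words (Some w) and the extra symbol e (None). *)
Notation cdhat k := {malg k[option cdword]}.

Section CD.
Variable k : fieldType.
Local Notation F := (cdalg k).
Local Notation Fhat := (cdhat k).
Local Notation FF := {tens k[cdword, cdword]}.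

Definition cvar : F := << fmu false >>.
Definition dvar : F := << fmu true >>.

Definition lmulF (u x : F) : F := u * x.
Definition rmulF (v x : F) : F := x * v.

Lemma lmulF_is_linear (u : F) : linear (lmulF u).
Proof.
move=> a x y; rewrite /lmulF mulrDr; congr (_ + _).
have uC : u * malgC a = a *: u.
  move: u; apply: eq_on_basis => [b v w|b v w|w].
  - by rewrite mulrDl scalerAl.
  - by rewrite scalerDr !scalerA mulrC.
  - rewrite malgM_def fgmulUU mul1r mulm1; apply/malgP => w'.
    by rewrite mcoeffZ !mcoeffU mulr_natr.
by rewrite -mul_malgC mulrA uC scalerAl.
Qed.

Lemma rmulF_is_linear (v : F) : linear (rmulF v).
Proof. by move=> a x y; rewrite /rmulF mulrDl scalerAl. Qed.

HB.instance Definition _ (u : F) :=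
  GRing.isLinear.Build k F F _ (lmulF u) (lmulF_is_linear u).
HB.instance Definition _ (v : F) :=
  GRing.isLinear.Build k F F _ (rmulF v) (rmulF_is_linear v).

Definition lactT (u : F) : FF -> FF := tmap (lmulF u) idfun.
Definition ractT (v : F) : FF -> FF := tmap idfun (rmulF v).

Lemma lactTE (u x y : F) : lactT u (x \ox y) = (u * x) \ox y.
Proof. exact: tmapE. Qed.

Lemma ractTE (v x y : F) : ractT v (x \ox y) = x \ox (y * v).
Proof. exact: tmapE. Qed.

Lemma lactT_is_linear (u : F) : linear (lactT u).
Proof. exact: tmap_is_linear. Qed.

Lemma ractT_is_linear (v : F) : linear (ractT v).
Proof. exact: tmap_is_linear. Qed.

Definition is_Delta (Delta : {linear F -> FF}) : Prop :=
  [/\ Delta 1 = 0,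
      Delta cvar = 2 *: (1 \ox 1),
      Delta dvar = 1 \ox cvar + cvar \ox 1 &
      forall u v : F, Delta (u * v) = ractT v (Delta u) + lactT u (Delta v)].

Definition is_G (G : {linear F -> F}) : Prop :=
  [/\ G 1 = 0,
      G cvar = dvar,
      G dvar = cvar * dvar &
      forall u v : F, G (u * v) = G u * v + u * G v].

Definition ehat : Fhat := << None >>.
Definition incl : F -> Fhat := mlin (fun w => << Some w >>).

HB.instance Definition _ := GRing.isLinear.Build k F Fhat _ incl
  (@mlin_is_linear _ _ _ _).

Definition ecoef (x : Fhat) : k := x@_None.
Definition fpart : Fhat -> F := mlin (fun o => if o is Some w then << w >> else 0).

HB.instance Definition _ := GRing.isLinear.Build k Fhat F _ fpart
  (@mlin_is_linear _ _ _ _).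

Lemma ecoef_is_linear : linear_for *%R ecoef.
Proof. by move=> a x y; rewrite /ecoef mcoeffD mcoeffZ. Qed.

Lemma ecoef_e : ecoef ehat = 1.
Proof. by rewrite /ecoef mcoeffUU. Qed.

Lemma fpart_e : fpart ehat = 0.
Proof. by rewrite /fpart mlinU. Qed.

Lemma fpart_incl : cancel incl fpart.
Proof.
apply: eq_on_basis => [a x y|//|w]; first by rewrite !linearP.
by rewrite /incl mlinU /fpart mlinU.
Qed.

Lemma ecoef_incl (u : F) : ecoef (incl u) = 0.
Proof.
rewrite /incl /mlin /ecoef -[LHS]/(mcoeff None _) raddf_sum big1 //= => w _.
by rewrite mcoeffZ mcoeffU mulr0.
Qed.

Lemma fhat_decomp (x : Fhat) : x = ecoef x *: ehat + incl (fpart x).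
Proof.
move: x; apply: eq_on_basis => [//|a x y|[w|]].
- rewrite ecoef_is_linear (linearP fpart) (linearP incl) /=.
  exact: lin2.
- by rewrite /ecoef mcoeffU scale0r add0r /fpart mlinU /incl mlinU.
- by rewrite ecoef_e scale1r fpart_e linear0 addr0.
Qed.

Section Hats.
Variables (Delta : {linear F -> FF}) (G : {linear F -> F}).

Definition Deltahat (x : Fhat) : {tens k[option cdword, option cdword]} :=
  let u := fpart x in
  ecoef x *: (ehat \ox ehat)
  + (tmap incl incl (Delta u) + ehat \ox incl u + incl u \ox ehat).

Definition Ghat (x : Fhat) : Fhat :=
  let u := fpart x in ecoef x *: incl 1 + incl (G u + u * cvar).

Lemma Deltahat_is_linear : linear Deltahat.
Proof.
move=> a x y; rewrite /Deltahat ecoef_is_linear (linearP fpart) /=.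
rewrite (linearP Delta) (linearP (tmap incl incl)) (linearP incl) /=.
rewrite tens_linearl tens_linearr.
exact: lin4.
Qed.

Lemma Ghat_is_linear : linear Ghat.
Proof.
move=> a x y; rewrite /Ghat ecoef_is_linear (linearP fpart) /=.
rewrite (linearP G) mulrDl -scalerAl lin1 (linearP incl) /=.
exact: lin2.
Qed.

HB.instance Definition _ :=
  GRing.isLinear.Build k Fhat {tens k[option cdword, option cdword]} _
    Deltahat Deltahat_is_linear.
HB.instance Definition _ :=
  GRing.isLinear.Build k Fhat Fhat _ Ghat Ghat_is_linear.

Lemma Deltahat_e : Deltahat ehat = ehat \ox ehat.
Proof.
rewrite /Deltahat ecoef_e fpart_e !linear0 scale1r.
rewrite (zero_of_linear (tens_linearr _)) (zero_of_linear (tens_linearl _)).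
by rewrite !addr0.
Qed.

Lemma Deltahat_incl (u : F) : Deltahat (incl u) =
  tmap incl incl (Delta u) + ehat \ox incl u + incl u \ox ehat.
Proof. by rewrite /Deltahat ecoef_incl fpart_incl scale0r add0r. Qed.

Lemma Ghat_e : Ghat ehat = incl 1.
Proof.
by rewrite /Ghat ecoef_e fpart_e linear0 mul0r addr0 linear0 addr0 scale1r.
Qed.

Lemma Ghat_incl (u : F) : Ghat (incl u) = incl (G u + u * cvar).
Proof. by rewrite /Ghat ecoef_incl fpart_incl scale0r add0r. Qed.

End Hats.

Section Derivation.
Variables (V : lmodType k) (L R : F -> V -> V) (D0 : bool -> V).
Hypotheses (Llin : forall u, linear (L u)) (Rlin : forall u, linear (R u)).
Hypotheses (Llinl : forall t, linear (L^~ t)) (Rlinl : forall t, linear (R^~ t)).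
Hypotheses (L1 : forall t, L 1 t = t) (R1 : forall t, R 1 t = t).
Hypothesis LM : forall u v t, L (u * v) t = L u (L v t).
Hypothesis RM : forall u v t, R (u * v) t = R v (R u t).
Hypothesis LR : forall u v t, L u (R v t) = R v (L u t).

Fixpoint der_word (s : seq bool) : V :=
  if s is x :: s' then R << FMonom s' >> (D0 x) + L << fmu x >> (der_word s')
  else 0.

Definition der : F -> V := mlin (fun w => der_word (fmonom_val w)).

HB.instance Definition _ := GRing.isLinear.Build k F V _ der
  (@mlin_is_linear _ _ _ _).

Lemma wordM (v w : cdword) : (<< v >> : F) * << w >> = << mmul v w >>.
Proof. by rewrite malgM_def fgmulUU mulr1. Qed.

Lemma der1 : der 1 = 0.
Proof. by rewrite /der mlinU fm1. Qed.

Lemma der_letter (x : bool) : der << fmu x >> = D0 x.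
Proof.
rewrite /der mlinU fmU /= (zero_of_linear (Llin _)) addr0.
by rewrite -[X in R X]/(<< FMonom [::] >>) -fmoneE R1.
Qed.

Lemma derM (u v : F) : der (u * v) = R v (der u) + L u (der v).
Proof.
move: u; apply: eq_on_basis => [a x y|a x y|w].
- by rewrite mulrDl -scalerAl linearP.
- rewrite linearP Rlin Llinl scalerDr -!addrA; congr (_ + _).
  by rewrite addrCA.
move: v; apply: eq_on_basis => [a x y|a x y|w'].
- by rewrite -!/(lmulF _ _) !linearP.
- rewrite linearP Llin Rlinl scalerDr -!addrA; congr (_ + _).
  by rewrite addrCA.
rewrite wordM /der !mlinU fmM.
case: w w' => s [s'] /=; elim: s => [|x s IHs] /=.
  rewrite (zero_of_linear (Rlin _)) add0r.
  by rewrite -fmoneE -[<< fmone bool >>]/(1 : F) L1.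
rewrite IHs (add_of_linear (Llin _)) (add_of_linear (Rlin _)).
rewrite LR -RM -LM !wordM addrA.
by rewrite /mmul /= !fmmulE fmuE.
Qed.

End Derivation.

Lemma derivation_ext (V : lmodType k) (L R : F -> V -> V)
    (D D' : {linear F -> V}) :
  D 1 = D' 1 -> D cvar = D' cvar -> D dvar = D' dvar ->
  (forall u v, D (u * v) = R v (D u) + L u (D v)) ->
  (forall u v, D' (u * v) = R v (D' u) + L u (D' v)) -> D =1 D'.
Proof.
move=> e1 ec ed eM eM'; apply: eq_on_basis => [||w]; try exact: linearP.
case: w; elim=> [|x s IHs]; first by rewrite -fmoneE.
have -> : << FMonom (x :: s) >> = << fmu x >> * << FMonom s >> :> F.
  by rewrite wordM /mmul /= fmmulE fmuE.
by rewrite eM eM' IHs; case: x; rewrite ?ed ?ec.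
Qed.

Theorem Delta_exists_unique : exists Delta, is_Delta Delta /\
  forall Delta', is_Delta Delta' -> Delta' =1 Delta.
Proof.
have lL := lactT_is_linear; have lR := ractT_is_linear.
have lLl t : linear (lactT^~ t).
  move=> a u v; move: t; apply: eq_on_tens => [||x y].
  - exact: lL.
  - by apply: linear_comb; exact: lL.
  by rewrite !lactTE mulrDl -scalerAl tens_linearl.
have lRl t : linear (ractT^~ t).
  move=> a u v; move: t; apply: eq_on_tens => [||x y].
  - exact: lR.
  - by apply: linear_comb; exact: lR.
  by rewrite !ractTE -!/(lmulF y _) linearP tens_linearr.
have L1 t : lactT 1 t = t.
  by move: t; apply: eq_on_tens => [||x y]; [exact: lL| |rewrite lactTE mul1r].
have R1 t : ractT 1 t = t.
  by move: t; apply: eq_on_tens => [||x y]; [exact: lR| |rewrite ractTE mulr1].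
have LM u v t : lactT (u * v) t = lactT u (lactT v t).
  move: t; apply: eq_on_tens => [||x y]; [exact: lL| |].
    by apply: linear_comp; exact: lL.
  by rewrite !lactTE mulrA.
have RM u v t : ractT (u * v) t = ractT v (ractT u t).
  move: t; apply: eq_on_tens => [||x y]; [exact: lR| |].
    by apply: linear_comp; exact: lR.
  by rewrite !ractTE mulrA.
have LR u v t : lactT u (ractT v t) = ractT v (lactT u t).
  move: t; apply: eq_on_tens => [||x y].
  - by apply: linear_comp; [exact: lL|exact: lR].
  - by apply: linear_comp; [exact: lR|exact: lL].
  apply: (etrans (congr1 (lactT u) (ractTE v x y))).
  apply: (etrans (lactTE _ _ _)); apply: esym.
  exact: (etrans (congr1 (ractT v) (lactTE u x y)) (ractTE _ _ _)).
pose D0 (x : bool) : FF :=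
  if x then 1 \ox cvar + cvar \ox 1 else 2 *: (1 \ox 1).
have D1 : is_Delta (der lactT ractT D0).
  split; first exact: der1.
  - exact: (der_letter D0 lL R1 false).
  - exact: (der_letter D0 lL R1 true).
  - exact: (derM D0 lL lR lLl lRl L1 LM RM LR).
exists (der lactT ractT D0); split=> // D' [D'1 D'c D'd D'M].
case: D1 => D1 Dc Dd DM.
apply: (@derivation_ext _ lactT ractT _ _ _ _ _ D'M DM).
- by rewrite D1 D'1.
- by rewrite Dc D'c.
- by rewrite Dd D'd.
Qed.

Theorem G_exists_unique : exists G, is_G G /\
  forall G', is_G G' -> G' =1 G.
Proof.
have lL := lmulF_is_linear; have lR := rmulF_is_linear.
have lLl t : linear (lmulF^~ t) by exact: lR.
have lRl t : linear (rmulF^~ t) by exact: lL.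
have L1 t : lmulF 1 t = t by exact: mul1r.
have R1 t : rmulF 1 t = t by exact: mulr1.
have LM u v t : lmulF (u * v) t = lmulF u (lmulF v t).
  exact: esym (mulrA u v t).
have RM u v t : rmulF (u * v) t = rmulF v (rmulF u t).
  exact: (mulrA t u v).
have LR u v t : lmulF u (rmulF v t) = rmulF v (lmulF u t).
  exact: (mulrA u t v).
pose D0 (x : bool) : F := if x then cvar * dvar else dvar.
have D1 : is_G (der lmulF rmulF D0).
  split; first exact: der1.
  - exact: (der_letter D0 lL R1 false).
  - exact: (der_letter D0 lL R1 true).
  - exact: (derM D0 lL lR lLl lRl L1 LM RM LR).
exists (der lmulF rmulF D0); split=> // D' [D'1 D'c D'd D'M].
case: D1 => D1 Dc Dd DM.
apply: (@derivation_ext _ lmulF rmulF _ _ _ _ _ D'M DM).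
- by rewrite D1 D'1.
- by rewrite Dc D'c.
- by rewrite Dd D'd.
Qed.

End CD.

Arguments cvar {k}.
Arguments dvar {k}.
Arguments ehat {k}.
Arguments incl {k}.

(* Main.v *)
Require Import Defs.
From HB Require Import structures.
From mathcomp Require Import all_boot all_algebra.
From mathcomp Require Import finmap.
From mathcomp.multinomials Require Import monalg.
Import GRing.Theory.
Local Open Scope ring_scope.

(** On [e] both sides are [e (x) 1 + 1 (x) e].  On a cd-polynomial [u], after
    cancelling the terms that contain [e], the claim becomes
      [Delta (G u) - (id (x) G + G (x) id) (Delta u)
        = 1 (x) u - u (x) 1 + mu (Delta u)]
    with [mu (x (x) y) = x c (x) y].  Each side is a derivation from [F] to the
    bimodule [F (x) F], so it suffices to compare them on [c] and [d]. *)

(** * Closure of linear maps under sums and opposites *)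

Section LinearPredicates.
#[local] Set Implicit Arguments.
#[local] Unset Strict Implicit.
Variable k : fieldType.

Lemma linear_add (U V : lmodType k) (f g : U -> V) :
  linear f -> linear g -> linear (fun x => f x + g x).
Proof. by move=> lf lg a x y; rewrite lf lg lin1. Qed.

Lemma linear_opp (U V : lmodType k) (f : U -> V) :
  linear f -> linear (fun x => - f x).
Proof. by move=> lf a x y; rewrite lf opprD scalerN. Qed.

End LinearPredicates.

(** * Functoriality and additivity of tensor products of maps *)

Section TensorMaps.
#[local] Set Implicit Arguments.
#[local] Unset Strict Implicit.
Variable k : fieldType.

Lemma tensDl (I J : choiceType) (y : {malg k[J]}) :
  {morph (fun x : {malg k[I]} => x \ox y) : x x' / x + x'}.
Proof. exact: (add_of_linear (tens_linearl y)). Qed.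

Lemma tensDr (I J : choiceType) (x : {malg k[I]}) :
  {morph (fun y : {malg k[J]} => x \ox y) : y y' / y + y'}.
Proof. exact: (add_of_linear (tens_linearr x)). Qed.

Lemma tmap_comp (I J I' J' I'' J'' : choiceType)
    (f : {linear {malg k[I']} -> {malg k[I'']}})
    (g : {linear {malg k[J']} -> {malg k[J'']}})
    (f' : {linear {malg k[I]} -> {malg k[I']}})
    (g' : {linear {malg k[J]} -> {malg k[J']}}) (t : {tens k[I, J]}) :
  tmap f g (tmap f' g' t) = tmap (f \o f') (g \o g') t.
Proof.
move: t; apply: eq_on_tens => [||x y]; last by rewrite !tmapE.
- exact: linear_comp (tmap_is_linear _ _) (tmap_is_linear _ _).
- exact: tmap_is_linear.
Qed.

Section Congruence.
Variables (I J I' J' : choiceType).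
Implicit Types (f : {linear {malg k[I]} -> {malg k[I']}}).
Implicit Types (g : {linear {malg k[J]} -> {malg k[J']}}).

Lemma eq_tmap f f1 g g1 (t : {tens k[I, J]}) :
  f =1 f1 -> g =1 g1 -> tmap f g t = tmap f1 g1 t.
Proof.
move=> ef eg; move: t; apply: eq_on_tens => [||x y]; try exact: tmap_is_linear.
by rewrite !tmapE ef eg.
Qed.

(** The second factors are only pointwise equal, because in use they are different bundled maps,
    such as [idfun] and [idfun \o idfun]. *)
Lemma tmap_splitl f f1 f2 g g1 g2 (t : {tens k[I, J]}) :
  (forall x, f x = f1 x + f2 x) -> g =1 g1 -> g =1 g2 ->
  tmap f g t = tmap f1 g1 t + tmap f2 g2 t.
Proof.
move=> ef eg1 eg2; move: t; apply: eq_on_tens => [||x y].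
- exact: tmap_is_linear.
- by apply: linear_add; apply: tmap_is_linear.
- by rewrite !tmapE ef tensDl -eg1 -eg2.
Qed.

Lemma tmap_splitr f f1 f2 g g1 g2 (t : {tens k[I, J]}) :
  f =1 f1 -> f =1 f2 -> (forall y, g y = g1 y + g2 y) ->
  tmap f g t = tmap f1 g1 t + tmap f2 g2 t.
Proof.
move=> ef1 ef2 eg; move: t; apply: eq_on_tens => [||x y].
- exact: tmap_is_linear.
- by apply: linear_add; apply: tmap_is_linear.
- by rewrite !tmapE eg tensDr -ef1 -ef2.
Qed.

End Congruence.
End TensorMaps.

(** Final bookkeeping on a cd-polynomial [u]: [b] is u (x) 1, which occurs twice because Delta(c) =
    2(1 (x) 1). One copy is absorbed by [E], the other is u (x) hat G(e). The terms [r], [x], [y]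
    occur identically on both sides. *)
Lemma assemble_terms (V : zmodType) (a b r x y n n' m q : V) :
  a + b = n + n' + m + q ->
  a + (r + (b + b)) + x + y = n + r + x + b + (n' + m + q + y).
Proof.
move=> E; rewrite [RHS](AC (4*4) ((1*5*6*7)*(2*4*3*8))) /= -E.
by rewrite [LHS](AC ((1*(1*2))*1*1) ((1*3)*(2*4*5*6))).
Qed.

(* The computations are carried out over an abstract bimodule: on [malg] itself,
   unification would unfold products and tensors. *)
Section CoderivationDefect.
#[local] Set Implicit Arguments.
#[local] Unset Strict Implicit.
(** Here [T] stands for the tensor, [L] and [R] for the outer actions, [D] for Delta, [N] for id (x)
    G + G (x) id and [M] for mu. *)
Variables (A : nzRingType) (V : zmodType).
Variables (T : A -> A -> V) (L R : A -> V -> V).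
Variables (D : A -> V) (G : A -> A) (N M : V -> V) (c d : A).

Hypothesis TDl : forall y, {morph T^~ y : x x' / x + x'}.
Hypothesis TDr : forall x, {morph T x : y y' / y + y'}.
Hypothesis LD : forall u, {morph L u : s t / s + t}.
Hypothesis RD : forall v, {morph R v : s t / s + t}.
Hypothesis LT : forall u x y, L u (T x y) = T (u * x) y.
Hypothesis RT : forall v x y, R v (T x y) = T x (y * v).

Hypothesis DD : {morph D : u v / u + v}.
Hypothesis D1 : D 1 = 0.
Hypothesis Dc : D c = T 1 1 + T 1 1.
Hypothesis Dd : D d = T 1 c + T c 1.
Hypothesis DM : forall u v, D (u * v) = R v (D u) + L u (D v).

Hypothesis G1 : G 1 = 0.
Hypothesis Gc : G c = d.
Hypothesis Gd : G d = c * d.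
Hypothesis GM : forall u v, G (u * v) = G u * v + u * G v.

Hypothesis ND : {morph N : s t / s + t}.
Hypothesis NT : forall x y, N (T x y) = T x (G y) + T (G x) y.
Hypothesis NL : forall u t, N (L u t) = L u (N t) + L (G u) t.
Hypothesis NR : forall v t, N (R v t) = R v (N t) + R (G v) t.

Hypothesis MD : {morph M : s t / s + t}.
Hypothesis MT : forall x y, M (T x y) = T (x * c) y.
Hypothesis ML : forall u t, M (L u t) = L u (M t).
Hypothesis MR : forall v t, M (R v t) = R v (M t).

Lemma morph_add0 (U W : zmodType) (f : U -> W) :
  {morph f : x y / x + y} -> f 0 = 0.
Proof. by move=> fD; apply: (addIr (f 0)); rewrite -fD !add0r. Qed.

Lemma morph_addN (U W : zmodType) (f : U -> W) :
  {morph f : x y / x + y} -> {morph f : x / - x}.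
Proof.
by move=> fD x; apply: (addIr (f x)); rewrite -fD !addNr morph_add0.
Qed.

Definition codefect (u : A) : V := D (G u) - N (D u).

(** The difference is the inner derivation attached to 1 (x) 1; the last term is a derivation
    followed by a bimodule map. *)
Definition corrector (u : A) : V := T 1 u - T u 1 + M (D u).

(** The mixed terms [R (G v) (D u)] and [L (G u) (D v)] arise both from [D (G (u * v))] and from
    [N (D (u * v))], hence cancel, as in a commutator of derivations. *)
Lemma codefectM (u v : A) :
  codefect (u * v) = R v (codefect u) + L u (codefect v).
Proof.
rewrite /codefect GM DD !DM ND NR NL RD LD (morph_addN (RD v)).
rewrite (morph_addN (LD u)).
set a := R v (D _); set b := L (G u) _; set e := R (G v) _.
set f := L u (D _); set g := R v (N _); set h := L u (N _).
have -> : a + b + (e + f) = a + f + (b + e) by rewrite [e + f]addrC addrACA.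
have -> : g + e + (h + b) = g + h + (b + e) by rewrite addrACA [e + b]addrC.
by rewrite [X in _ - X]addrC opprD addrA addrK opprD addrACA.
Qed.

(** The inner part telescopes through [T u v]; [M] commutes with both actions. *)
Lemma correctorM (u v : A) :
  corrector (u * v) = R v (corrector u) + L u (corrector v).
Proof.
rewrite /corrector DM MD MR ML !RD !LD (morph_addN (RD v)).
rewrite (morph_addN (LD u)) !RT !LT mul1r mulr1.
by rewrite [RHS]addrACA subrKA.
Qed.

Lemma codefect1 : codefect 1 = corrector 1.
Proof.
rewrite /codefect /corrector G1 D1 (morph_add0 DD) (morph_add0 ND).
by rewrite (morph_add0 MD) !subrr addr0.
Qed.

(** Both sides reduce to [T 1 c + T c 1]; [N] kills [D c] since [G 1 = 0]. *)
Lemma codefect_c : codefect c = corrector c.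
Proof.
rewrite /codefect /corrector Gc Dc Dd ND MD NT MT G1 mul1r.
rewrite (morph_add0 (TDr 1)) (morph_add0 (TDl 1)) !addr0 subr0.
by rewrite addrA subrK.
Qed.

(** Both sides reduce to [T 1 d - T d 1 + T c c + T (c * c) 1]; one of the two copies of [T 1 d] in
    [D (c * d)] cancels against [N (D d)]. *)
Lemma codefect_d : codefect d = corrector d.
Proof.
rewrite /codefect /corrector Gd DM Dc Dd ND MD RD LD !NT !MT !RT !LT.
rewrite G1 Gc !mul1r mulr1 (morph_add0 (TDr c)) (morph_add0 (TDl c)).
rewrite addr0 add0r opprD [LHS]addrACA addrK.
by rewrite [X in _ + X = _]addrC addrA.
Qed.

Lemma codefect_eq_exchange (u : A) : codefect u = corrector u ->
  D (G u) + T u 1 = N (D u) + M (D u) + T 1 u.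
Proof.
move=> /(canRL (subrK _)) ->; rewrite /corrector.
rewrite -!addrA [RHS]addrA [RHS]addrC; congr (_ + _).
by rewrite [X in - _ + X]addrA [X in - _ + X]addrC addKr addrC.
Qed.

End CoderivationDefect.

(** * The defect identity for Delta and G on cd-polynomials *)

Section Coderivation.
#[local] Set Implicit Arguments.
#[local] Unset Strict Implicit.
Variable k : fieldType.
Local Notation F := (cdalg k).
Local Notation FF := {tens k[cdword, cdword]}.
Variables (Delta : {linear F -> FF}) (G : {linear F -> F}).
Hypotheses (DeltaP : is_Delta Delta) (GP : is_G G).

Definition muc : FF -> FF := tmap (rmulF cvar) idfun.

Definition tder (t : FF) : FF := tmap idfun G t + tmap G idfun t.

Lemma tder_is_linear : linear tder.
Proof. by apply: linear_add; apply: tmap_is_linear. Qed.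

Lemma tderE (x y : F) : tder (x \ox y) = x \ox G y + G x \ox y.
Proof. by rewrite /tder !tmapE. Qed.

(** The two maps multiply the first factor on opposite sides, so associativity suffices. *)
Lemma muc_lactT (u : F) (t : FF) : muc (lactT u t) = lactT u (muc t).
Proof.
apply: (etrans (tmap_comp _ _ _ _ _)); apply: esym.
apply: (etrans (tmap_comp _ _ _ _ _)); apply: eq_tmap => [x|//].
exact: (mulrA u x cvar).
Qed.

Lemma muc_ractT (v : F) (t : FF) : muc (ractT v t) = ractT v (muc t).
Proof.
apply: (etrans (tmap_comp _ _ _ _ _)); apply: esym.
exact: (etrans (tmap_comp _ _ _ _ _) (eq_tmap _ _ _)).
Qed.

(** Applying [G] to the second factor commutes with the left action; on the first factor the Leibniz
    rule produces the extra term. *)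
Lemma tder_lactT (u : F) (t : FF) :
  tder (lactT u t) = lactT u (tder t) + lactT (G u) t.
Proof.
case: GP => _ _ _ GM.
have -> : lactT u (tder t) = lactT u (tmap idfun G t) + lactT u (tmap G idfun t).
  exact: (add_of_linear (lactT_is_linear u)).
apply: (etrans _ (addrA _ _ _)); apply: congr2.
  apply: (etrans (tmap_comp _ _ _ _ _)); apply: esym.
  exact: (etrans (tmap_comp _ _ _ _ _) (eq_tmap _ _ _)).
apply: (etrans (tmap_comp _ _ _ _ _)).
apply: (etrans (tmap_splitl (f1 := lmulF u \o G) (f2 := lmulF (G u))
  (g1 := idfun \o idfun) (g2 := idfun) _ _ _ _)) => [x|//|//|].
  exact: (etrans (GM u x) (addrC _ _)).
by apply: congr2; [exact: (esym (tmap_comp _ _ _ _ _)) |].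
Qed.

Lemma tder_ractT (v : F) (t : FF) :
  tder (ractT v t) = ractT v (tder t) + ractT (G v) t.
Proof.
case: GP => _ _ _ GM.
have -> : ractT v (tder t) = ractT v (tmap idfun G t) + ractT v (tmap G idfun t).
  exact: (add_of_linear (ractT_is_linear v)).
apply: (etrans _ (addrAC _ _ _)); apply: congr2; last first.
  apply: (etrans (tmap_comp _ _ _ _ _)); apply: esym.
  exact: (etrans (tmap_comp _ _ _ _ _) (eq_tmap _ _ _)).
apply: (etrans (tmap_comp _ _ _ _ _)).
apply: (etrans (tmap_splitr (f1 := idfun \o idfun) (f2 := idfun)
  (g1 := rmulF v \o G) (g2 := rmulF (G v)) _ _ _ _)) => [//|//|y|].
  exact: GM.
by apply: congr2; [exact: (esym (tmap_comp _ _ _ _ _)) |].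
Qed.

(** Scalar-free form, as required by the abstract bimodule, which is only an additive group. *)
Lemma Delta_cvar : Delta cvar = 1 \ox 1 + 1 \ox 1.
Proof.
case: DeltaP => _ Dc _ _.
exact: (etrans Dc (etrans (scaler_nat 2 _) (mulr2n _))).
Qed.

Lemma Delta_G (u : F) : Delta (G u) + u \ox 1 =
  tder (Delta u) + muc (Delta u) + 1 \ox u.
Proof.
have tD : {morph tder : s t / s + t} := add_of_linear tder_is_linear.
have mD : {morph muc : s t / s + t} := add_of_linear (tmap_is_linear _ _).
have lD (v : F) : {morph lactT v : s t / s + t}.
  exact: (add_of_linear (lactT_is_linear v)).
have rD (v : F) : {morph ractT v : s t / s + t}.
  exact: (add_of_linear (ractT_is_linear v)).
have DD : {morph Delta : x y / x + y} := add_of_linear (linearP Delta).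
have mE (x y : F) : muc (x \ox y) = (x * cvar) \ox y by exact: tmapE.
case: DeltaP GP => D1 _ Dd DM [G1 Gc Gd GM].
pose cf := codefect Delta G tder.
pose cr := corrector (@tens k _ _) Delta muc.
have cf_lin : linear cf.
  apply: linear_add; first by apply: linear_comp; apply: linearP.
  apply: linear_opp; apply: linear_comp; last exact: linearP.
  exact: tder_is_linear.
have cr_lin : linear cr.
  apply: linear_add; last first.
    by apply: linear_comp; [exact: tmap_is_linear | exact: linearP].
  apply: linear_add; first exact: tens_linearr.
  exact: linear_opp (tens_linearl _).
(* Both derivations are bundled as linear maps so that [derivation_ext] reduces their equality to
   the values at 1, c and d. *)
pose cfL : {linear F -> FF} := HB.pack cf (GRing.isLinear.Build k F FF _ cf cf_lin).
pose crL : {linear F -> FF} := HB.pack cr (GRing.isLinear.Build k F FF _ cr cr_lin).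
apply: (@codefect_eq_exchange F FF).
apply: (@derivation_ext k FF (@lactT k) (@ractT k) cfL crL).
- exact: (codefect1 (@tens k _ _) DD D1 G1 tD mD).
- exact: (codefect_c (@tensDl k _ _) (@tensDr k _ _) Delta_cvar Dd G1 Gc tD tderE mD mE).
- exact: (codefect_d (@tensDl k _ _) (@tensDr k _ _) lD rD (@lactTE k)
    (@ractTE k) Delta_cvar Dd DM G1 Gc Gd tD tderE mD mE).
- exact: (codefectM lD rD DD DM GM tD tder_lactT tder_ractT).
- exact: (correctorM lD rD (@lactTE k) (@ractTE k) DM mD muc_lactT muc_ractT).
Qed.

(** * Transport to the extended space, for cd-polynomials *)

Local Notation inclT := (tmap (@incl k) (@incl k)).

(** Right multiplication by c in hat G is the outer right action when applied to the second factor,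
    but the inner multiplication mu when applied to the first. *)
Lemma tmap_Ghatr_incl (t : FF) : tmap idfun (Ghat G) (inclT t) =
  inclT (tmap idfun G t) + inclT (ractT cvar t).
Proof.
apply: (etrans (tmap_comp _ _ _ _ _)).
apply: (etrans (tmap_splitr (f1 := incl \o idfun) (f2 := incl \o idfun)
  (g1 := incl \o G) (g2 := incl \o rmulF cvar) _ _ _ _)) => [//|//|y|].
  exact: (etrans (Ghat_incl G y) (raddfD _ _ _)).
by apply: congr2; exact: (esym (tmap_comp _ _ _ _ _)).
Qed.

Lemma tmap_Ghatl_incl (t : FF) : tmap (Ghat G) idfun (inclT t) =
  inclT (tmap G idfun t) + inclT (muc t).
Proof.
apply: (etrans (tmap_comp _ _ _ _ _)).
apply: (etrans (tmap_splitl (f1 := incl \o G) (f2 := incl \o rmulF cvar)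
  (g1 := incl \o idfun) (g2 := incl \o idfun) _ _ _ _)) => [x|//|//|].
  exact: (etrans (Ghat_incl G x) (raddfD _ _ _)).
by apply: congr2; exact: (esym (tmap_comp _ _ _ _ _)).
Qed.

(** The two copies of u (x) 1 come from u acting on Delta(c). *)
Lemma Delta_mulc (u : F) :
  Delta (u * cvar) = ractT cvar (Delta u) + (u \ox 1 + u \ox 1).
Proof.
case: DeltaP => _ _ _ DM; apply: (etrans (DM _ _)); apply: congr2 => //.
rewrite Delta_cvar.
apply: (etrans (add_of_linear (lactT_is_linear u) _ _)).
by apply: congr2; apply: (etrans (lactTE _ _ _)); apply: congr2 (mulr1 u) _.
Qed.

Lemma inclT_Delta_Ghat (u : F) :
  inclT (Delta (G u + u * cvar)) =
  inclT (Delta (G u)) +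
    (inclT (ractT cvar (Delta u)) + (incl u \ox incl 1 + incl u \ox incl 1)).
Proof.
have iD : {morph inclT : s t / s + t} := add_of_linear (tmap_is_linear _ _).
apply: (etrans (congr1 inclT (add_of_linear (linearP Delta) _ _))).
apply: (etrans (iD _ _)); apply: congr2 => //.
apply: (etrans (congr1 inclT (Delta_mulc u))).
apply: (etrans (iD _ _)); apply: congr2 => //.
by apply: (etrans (iD _ _)); apply: congr2; exact: tmapE.
Qed.

Lemma inclT_Delta_G (u : F) :
  inclT (Delta (G u)) + incl u \ox incl 1 =
  inclT (tmap idfun G (Delta u)) + inclT (tmap G idfun (Delta u)) +
    inclT (muc (Delta u)) + incl 1 \ox incl u.
Proof.
have iD : {morph inclT : s t / s + t} := add_of_linear (tmap_is_linear _ _).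
have iE x y : incl x \ox incl y = inclT (x \ox y) by exact: (esym (tmapE _ _ _ _)).
rewrite (iE u 1) (iE 1 u); apply: (etrans (esym (iD _ _))).
apply: (etrans (congr1 inclT (Delta_G u))).
apply: (etrans (iD _ _)); apply: congr2 => //.
apply: (etrans (iD _ _)); apply: congr2 => //.
exact: iD.
Qed.

Lemma Ghat_coderivation_incl (u : F) :
  Deltahat Delta (Ghat G (incl u)) =
  tmap idfun (Ghat G) (Deltahat Delta (incl u)) +
  tmap (Ghat G) idfun (Deltahat Delta (incl u)).
Proof.
have rD := add_of_linear (tmap_is_linear (@idfun (cdhat k)) (Ghat G)).
have lD := add_of_linear (tmap_is_linear (Ghat G) (@idfun (cdhat k))).
have DG : Deltahat Delta (Ghat G (incl u)) =
    inclT (Delta (G u + u * cvar)) + ehat \ox Ghat G (incl u) +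
    Ghat G (incl u) \ox ehat.
  by rewrite Ghat_incl Deltahat_incl.
(* The last summand is the image of u (x) e, because hat G(e) = 1; in the mirror computation below,
   e (x) u gives 1 (x) u. *)
have GrD : tmap idfun (Ghat G) (Deltahat Delta (incl u)) =
    inclT (tmap idfun G (Delta u)) + inclT (ractT cvar (Delta u)) +
    ehat \ox Ghat G (incl u) + incl u \ox incl 1.
  rewrite Deltahat_incl; apply: (etrans (rD _ _)); apply: congr2; last first.
    apply: (etrans (tmapE _ _ _ _)).
    exact: (congr1 (fun z => incl u \ox z) (Ghat_e G)).
  apply: (etrans (rD _ _)).
  by apply: congr2; [exact: tmap_Ghatr_incl | exact: tmapE].
have GlD : tmap (Ghat G) idfun (Deltahat Delta (incl u)) =
    inclT (tmap G idfun (Delta u)) + inclT (muc (Delta u)) +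
    incl 1 \ox incl u + Ghat G (incl u) \ox ehat.
  rewrite Deltahat_incl; apply: (etrans (lD _ _)); apply: congr2; last first.
    exact: tmapE.
  apply: (etrans (lD _ _)); apply: congr2; first exact: tmap_Ghatl_incl.
  apply: (etrans (tmapE _ _ _ _)).
  exact: (congr1 (fun z => z \ox incl u) (Ghat_e G)).
rewrite DG GrD GlD inclT_Delta_Ghat.
exact: assemble_terms (inclT_Delta_G u).
Qed.

End Coderivation.

Theorem theorem2p3 (k : fieldType) (char0 : [pchar k] =i pred0)
    (Delta : {linear cdalg k -> {tens k[cdword, cdword]}})
    (DeltaP : is_Delta Delta)
    (G : {linear cdalg k -> cdalg k}) (GP : is_G G) :
  Deltahat Delta \o Ghat G
    =1 (tmap idfun (Ghat G) \+ tmap (Ghat G) idfun) \o Deltahat Delta.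
Proof.
have lD := Deltahat_is_linear Delta; have lG := Ghat_is_linear G.
(* Both sides are linear, so words and the symbol e suffice. *)
apply: eq_on_basis => [||[w|]].
- exact: linear_comp lD lG.
- by apply: linear_comp lD; apply: linear_add; apply: tmap_is_linear.
- have -> : << Some w >> = incl << w >> :> cdhat k by rewrite /incl mlinU.
  exact: Ghat_coderivation_incl.
- rewrite -[<< None >>]/ehat /= Deltahat_e !tmapE /= Ghat_e Deltahat_incl.
  (* As hat G(e) = 1, the only possible extra term is Delta(1), which vanishes. *)
  by case: DeltaP => -> _ _ _; rewrite linear0 add0r.
Qed.
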